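(* Let $K$ be a field of characteristic $0$ and let $f:\mathbb{Z}\to\mathrm{Sym}(n\times n,K)$ satisfy $\operatorname{rk}(f(x+y)-f(x)-f(y))\le1$ for all $x,y\in\mathbb{Z}$ and $f(1)=0$. Let $\Delta(i)=f(i+1)-f(i)$ and $L_i=\operatorname{im}(\Delta(i))$, and assume $\dim\big(\sum_{i\in\mathbb{Z}\setminus\{0,-1\}}L_i\big)\ge3$. Then there is a natural number $p\ge2$ such that $\Delta$ is APAP with period $p$. Moreover, $p$ can be chosen such that $\dim(L_1+\cdots+L_{p-2})\le2$; in particular $\operatorname{rk}\big(\Delta(1)+\cdots+\Delta(p-2)\big)\le2$.
   Context: A map $\Delta:\mathbb{Z}\to H$ ($H$ an abelian group) is APAP (almost periodic almost palindromic) with period $p\ge2$ if: (i) $\Delta(i+p)=\Delta(i)$ for all $i\in\mathbb{Z}$ with $i\not\equiv -1,0\pmod p$; (ii) $\Delta(j-1)+\Delta(j)=0$ for all $j\in\mathbb{Z}$ with $p\mid j$; (iii) $\Delta(p-1-i)=\Delta(i)$ for all $i=1,\ldots,p-2$. $\mathrm{Sym}(n\times n,K)$ is the space of symmetric matrices; $\operatorname{im}$ denotes column space. *)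

(* Defs.v *)
From mathcomp Require Import all_boot all_order all_algebra.
From Stdlib Require Import Classical.

Set Implicit Arguments.
Unset Strict Implicit.
Unset Printing Implicit Defensive.

Import Order.TTheory GRing.Theory Num.Theory.

Local Open Scope ring_scope.

(* Almost periodic almost palindromic with period p. *)
Definition apap (H : zmodType) (D : int -> H) (p : nat) : Prop :=
  [/\ (2 <= p)%N,
      forall i : int, (i != -1 %[mod p])%Z -> (i != 0 %[mod p])%Z ->
        D (i + p%:Z) = D i,
      forall j : int, (p %| j)%Z -> D (j - 1) + D j = 0
    & forall i : int, 1 <= i <= p%:Z - 2 -> D (p%:Z - 1 - i) = D i].

Definition fdiff (H : zmodType) (f : int -> H) (i : int) : H :=
  f (i + 1) - f i.

Definition colspace (K : fieldType) (m n : nat) (A : 'M[K]_(m, n)) :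
    {vspace 'cV[K]_m} :=
  limg (linfun (fun v : 'cV[K]_n => A *m v)).

(* Big operators only sum finite families, so the sum of an arbitrary family
   is characterised by membership in one of its finite subsums; it exists and
   is unique by is_sumv_exists and is_sumv_uniq. *)
Definition is_sumv (K : fieldType) (vT : vectType K) (I : Type) (P : pred I)
    (L : I -> {vspace vT}) (U : {vspace vT}) : Prop :=
  forall v : vT,
    v \in U <-> exists2 s : seq I, all P s & v \in (\sum_(i <- s) L i)%VS.

Lemma mem_colspace (K : fieldType) (m n : nat) (A : 'M[K]_(m, n))
    (w : 'cV[K]_m) :
  reflect (exists v : 'cV[K]_n, w = A *m v) (w \in colspace A).
Proof.
apply: (iffP memv_imgP) => [[v _ ->]|[v ->]]; exists v => //.
- by rewrite lfunE.
- exact: memvf.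
- by rewrite lfunE.
Qed.

Lemma is_sumv_uniq (K : fieldType) (vT : vectType K) (I : Type) (P : pred I)
    (L : I -> {vspace vT}) (U V : {vspace vT}) :
  is_sumv P L U -> is_sumv P L V -> U = V.
Proof.
move=> hU hV; apply/vspaceP => v.
by apply/idP/idP => [/hU/hV|/hV/hU].
Qed.

Lemma is_sumv_exists (K : fieldType) (vT : vectType K) (I : Type) (P : pred I)
    (L : I -> {vspace vT}) : exists U : {vspace vT}, is_sumv P L U.
Proof.
pose S s := (\sum_(i <- s) L i)%VS.
have step k s : all P s -> (\dim {:vT} - \dim (S s) <= k)%N ->
    exists U, is_sumv P L U.
  elim: k s => [|k IH] s Ps hk.
    exists (S s) => v; split=> [vs|_]; first by exists s.
    have /eqP-> : S s == fullv; last exact: memvf.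
    by rewrite eqEdim subvf /= -subn_eq0 -leqn0.
  have [[t [Pt ht]]|no] := classic (exists t, all P t /\ ~~ (S t <= S s)%VS).
    apply: (IH (t ++ s)); first by rewrite all_cat Pt.
    have St : S (t ++ s) = (S t + S s)%VS by rewrite /S big_cat.
    have lt : (\dim (S s) < \dim (S (t ++ s)))%N.
      rewrite ltnNge; apply: contra ht => le.
      have /eqP -> : S s == S (t ++ s) by rewrite eqEdim le St addvSr.
      by rewrite St addvSl.
    have le := dimvS (subvf (S (t ++ s))).
    rewrite -ltnS; apply: leq_trans hk; apply: ltn_sub2l => //.
    exact: leq_trans lt le.
  exists (S s) => v; split=> [vs|[t Pt vt]]; first by exists s.
  have [/subvP h|h] := boolP (S t <= S s)%VS; first exact: h.
  by case: no; exists t.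
exact: (step _ [::]).
Qed.

(* Main.v *)
(** A symmetric [Y] supported in a space [W] vanishes as soon as [Y + B] has
    rank at most 1 for some symmetric rank-one [B] not supported in [W].  Hence
    any difference [D i = f (i + 1) - f i] leaving the span of other values of
    [f] turns rank conditions into exact equations.

    First [f (-1) = 0], for otherwise every [D i] lives in the image of
    [f (-1)], of rank at most 2.  So [x |-> f (-x)] satisfies the hypotheses
    too.  Almost periodicity amounts to the existence of an odd function [phi],
    quasi-periodic of period [p], that coincides with [f] off the multiples
    of [p].

    If the differences at positive indices span at least three dimensions,
    take [m] least with [D 1, ..., D (m - 1)] spanning three; then the block
    before [m] is palindromic.  Among the divisors [p >= 2] of [m] for which
    some [phi] as above matches [f] below [m], take the least one.  The windows
    [f (x + j) - f x - f j] with [j <= m] propagate [f = phi] to all integers,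
    unless [phi] is also additive, up to a defect [E], under a shift [i < p];
    then the [gcd] of [i] and [p] contradicts either the minimality of [p] or
    the dimension of the span.

    If neither side spans three dimensions, then neither span contains the
    other.  The first index at which one side leaves the span of the other is
    the period, and all the equations become exact at once. *)

Require Import Defs.
From mathcomp Require Import all_boot all_order all_algebra.
From mathcomp Require Import zify ring.
From Stdlib Require Import Classical.

Set Implicit Arguments.
Unset Strict Implicit.
Unset Printing Implicit Defensive.

Import Order.TTheory GRing.Theory Num.Theory.
Local Open Scope ring_scope.

Ltac mxring := by apply/matrixP => ? ?; rewrite !mxE; ring.

(** * Rank-one perturbations of symmetric matrices *)

Section LinearAlgebra.
Variables (K : fieldType) (n : nat).
Implicit Types A B Q W Y : 'M[K]_n.

(** The cokernel [C] of [W] kills [Y], so [C^T *m (Y + B)] equals [C^T *m B], which is nonzero. It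
    spans the row space of [Y + B], whence [Y <= B]; a nonzero [Y] would then have the row space of
    [B], putting [B] inside [W]. *)
Lemma sym_add_rank1_eq0 W Y B :
  Y^T = Y -> B^T = B -> (\rank B <= 1)%N ->
  (\rank (Y + B)%R <= 1)%N -> (Y <= W)%MS -> ~~ (B <= W)%MS -> Y = 0.
Proof.
move=> Ys Bs rB rYB YW BW.
set C := cokermx W.
have YC : C^T *m Y = 0.
  apply: trmx_inj; rewrite trmx_mul trmxK Ys trmx0.
  by apply/eqP; rewrite -submxE.
have BC : (0 < \rank (C^T *m B))%N.
  rewrite lt0n mxrank_eq0; apply: contra BW => /eqP BC.
  by rewrite submxE -Bs -[cokermx W]trmxK -trmx_mul BC trmx0.
have full A : (\rank A <= 1)%N -> (C^T *m B <= A)%MS -> (A <= C^T *m B)%MS.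
  move=> rA sA; have [_ ] := mxrank_leqif_eq sA.
  rewrite eqn_leq (mxrankS sA) (leq_trans rA BC) /=.
  by move=> /esym/andP[].
have sYB : (C^T *m B <= (Y + B)%R)%MS.
  have -> : C^T *m B = C^T *m (Y + B) by rewrite mulmxDr YC add0r.
  exact: submxMl.
have YB : (Y <= B)%MS.
  have -> : Y = (Y + B) - B by rewrite addrK.
  apply: addmx_sub; last by rewrite eqmx_opp.
  apply: submx_trans (full _ rYB sYB) _.
  exact: submxMl.
apply/eqP/negPn; apply: contra BW => Y0.
have [_ ] := mxrank_leqif_eq YB.
rewrite eqn_leq (mxrankS YB) (leq_trans rB) ?lt0n ?mxrank_eq0 //=.
by move=> /esym/andP[_ BY]; apply: submx_trans BY YW.
Qed.

Lemma sym_sub_rank1_submx A Q :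
  A^T = A -> Q^T = Q -> (\rank A <= 1)%N ->
  (\rank (Q - A)%R <= 1)%N -> Q != 0 -> (A <= Q)%MS.
Proof.
move=> As Qs rA rQA; apply: contraNT => AQ; apply/eqP.
apply: (@sym_add_rank1_eq0 Q Q (- A)) => //.
- by rewrite linearN /= As.
- by rewrite mxrank_opp.
- by rewrite eqmx_opp.
Qed.

(** In the factorisation of [A] as [col_base A *m row_base A], the first factor has only [\rank A]
    columns. *)
Lemma dim_colspace m (A : 'M[K]_(m, n)) : (\dim (colspace A) <= \rank A)%N.
Proof.
have sub : (colspace A <= colspace (col_base A))%VS.
  apply/subvP => _ /mem_colspace[v ->]; apply/mem_colspace.
  by exists (row_base A *m v); rewrite mulmxA mulmx_base.
apply: leq_trans (dimvS sub) _.
move: (\rank A) (col_base A) => r B.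
have := limg_ker_dim (linfun (fun v : 'cV[K]_r => B *m v)) fullv.
rewrite dimvf dim_matrix mulr1 => {2}<-.
exact: leq_addl.
Qed.

(** Matrix inclusion compares row spaces; symmetry of [A] and a transpose of [W] convert it to
    column spaces. *)
Lemma colspaceS A W :
  A^T = A -> (A <= W)%MS -> (colspace A <= colspace W^T)%VS.
Proof.
move=> As /submxP[B AW].
apply/subvP => _ /mem_colspace[v ->]; apply/mem_colspace.
by exists (B^T *m v); rewrite mulmxA -trmx_mul -AW As.
Qed.

End LinearAlgebra.

(** * Additive shifts of quasi-periodic functions *)

Section QuasiPeriodic.
Variables (K : fieldType) (n : nat).
Hypothesis hK : [pchar K] =i pred0.
Implicit Types (phi : int -> 'M[K]_n) (E : 'M[K]_n) (p i : nat).

Lemma mulrn_submx (M E : 'M[K]_n) k :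
  (0 < k)%N -> (M *+ k <= E)%MS -> (M <= E)%MS.
Proof.
move=> k0; rewrite -scaler_nat eqmx_scale //.
by have /pcharf0P -> := hK; rewrite -lt0n.
Qed.

Lemma mulrn_eq0 (M : 'M[K]_n) k : (0 < k)%N -> M *+ k = 0 -> M = 0.
Proof.
move=> k0 Mk; apply/eqP; rewrite -submx0; apply: (@mulrn_submx _ _ k) => //.
by rewrite Mk sub0mx.
Qed.

Definition additive_shift E phi (a : int) :=
  forall j : int, ((phi (j + a) - phi j - phi a)%R <= E)%MS.

Lemma additive_shift0 phi a :
  additive_shift 0 phi a -> forall j, phi (j + a) = phi j + phi a.
Proof.
move=> h j; have := h j; rewrite submx0 => /eqP e.
by apply/eqP; rewrite -subr_eq0 opprD addrA e.
Qed.

(** Shifts additive modulo the row space of [E] are closed under opposites and sums; being a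
    subgroup, they are also closed under gcd. *)
Lemma additive_shift_mul E phi a :
  phi 0 = 0 -> additive_shift E phi a ->
  forall k : int, additive_shift E phi (k * a).
Proof.
move=> phi0 ha.
have hN b : additive_shift E phi b -> additive_shift E phi (- b).
  move=> hb j.
  have := hb (- b); have := hb (j - b); rewrite subrK addNr phi0 => h1 h2.
  rewrite (_ : _ - _ = (phi 0 - phi (- b) - phi b) -
    (phi j - phi (j - b) - phi b)); last by rewrite phi0; mxring.
  by rewrite phi0 addmx_sub // eqmx_opp.
have hD b c : additive_shift E phi b -> additive_shift E phi c ->
    additive_shift E phi (b + c).
  move=> hb hc j; rewrite addrA.
  rewrite (_ : _ - _ = (phi (j + b + c) - phi (j + b) - phi c) +
    (phi (j + b) - phi j - phi b) - (phi (b + c) - phi b - phi c));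
    last by mxring.
  by apply: addmx_sub; [apply: addmx_sub | rewrite eqmx_opp];
    [apply: hc | apply: hb | apply: hc].
have h (k : nat) : additive_shift E phi (k%:Z * a).
  elim: k => [|k IH]; last by rewrite intS mulrDl mul1r; apply: hD.
  by move=> j; rewrite mul0r addr0 phi0 subrr subr0 sub0mx.
by case=> k; rewrite ?NegzE ?mulNr; [apply: h | apply/hN/h].
Qed.

Lemma additive_shift_gcd E phi p i :
  phi 0 = 0 -> additive_shift E phi p -> additive_shift E phi i ->
  additive_shift E phi (gcdn p i).
Proof.
move=> phi0 hp hi.
have [u [v]] := Bezoutz p i; rewrite /gcdz /= => <- j.
have hu := additive_shift_mul phi0 hp u.
have hv := additive_shift_mul phi0 hi v.
rewrite addrA.
rewrite (_ : _ - _ = (phi (j + u * p + v * i) - phi (j + u * p) - phi (v * i)) +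
    (phi (j + u * p) - phi j - phi (u * p)) -
    (phi (u * p + v * i) - phi (u * p) - phi (v * i))); last by mxring.
by apply: addmx_sub; [apply: addmx_sub | rewrite eqmx_opp];
  [apply: hv | apply: hu | apply: hv].
Qed.

Lemma additive_shift_dvd phi p :
  phi 0 = 0 -> (forall x, phi (x + p%:Z) = phi x + phi p%:Z) ->
  forall (d x : int), (p %| d)%Z -> phi (x + d) = phi x + phi d.
Proof.
move=> phi0 pper d x /dvdzP[k ->]; apply: additive_shift0.
by apply: additive_shift_mul => // j; rewrite pper addrAC addrK subrr sub0mx.
Qed.

(* [phi] is additive under the shift by [i], up to [E], except at [0] and [i]
   mod [p], where oddness makes it exactly additive. *)
Section BrokenShift.
Variables (phi : int -> 'M[K]_n) (p i : nat) (E : 'M[K]_n).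
Hypotheses (phi0 : phi 0 = 0) (podd : forall x, phi (- x) = - phi x).
Hypothesis pper : forall x, phi (x + p%:Z) = phi x + phi p%:Z.
Hypothesis ip : (0 < i < p)%N.
Hypothesis broken : forall j : int, ~~ (p %| j)%Z -> ~~ (p %| j - i%:Z)%Z ->
  phi j = phi (j - i%:Z) + phi i%:Z - E.

Let pd := additive_shift_dvd phi0 pper.

Lemma broken_shift_gcd : additive_shift E phi (gcdn p i).
Proof.
apply: additive_shift_gcd => // j.
  by rewrite pper addrAC addrK subrr sub0mx.
have [pji|pji] := boolP (p %| j + i%:Z)%Z.
  have -> : phi j = phi (j + i%:Z) - phi i%:Z.
    by rewrite -podd addrC -pd // addrCA addNr addr0.
  by rewrite subKr subrr sub0mx.
have [pj|pj] := boolP (p %| j)%Z.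
  by rewrite [j + _]addrC pd // addrK subrr sub0mx.
rewrite broken ?addrK //.
rewrite (_ : _ - _ = - E); last by mxring.
by rewrite eqmx_opp.
Qed.

Lemma broken_shift_defect0 : (1 < gcdn p i)%N -> E = 0.
Proof.
move=> g1; have [i0 ltip] := andP ip; have p0 : (0 < p)%N by lia.
have phiM c : phi (c * p)%N%:Z = phi p%:Z *+ c.
  elim: c => [|c IH]; first by rewrite mul0n phi0.
  by rewrite mulSn PoszD addrC pper IH mulrSr.
set D := phi i%:Z - E.
have ng1 k : ~~ (p %| 1 + (k * i)%N%:Z)%Z.
  apply/negP => h.
  have : (gcdn p i %| 1 + (k * i)%N%:Z)%Z.
    by apply: dvdz_trans h; rewrite dvdzE /= dvdn_gcdl.
  rewrite dvdzE /= dvdn_addl ?dvdn_mull ?dvdn_gcdr // dvdn1.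
  by move/eqP=> e; rewrite e in g1.
(* The orbit of 1 avoids 0 and i mod p, which gives p (phi i - E) = i (phi p);
   the orbit of 0 meets both, and going once around it costs 2 E less. *)
have hr k : phi (1 + (k * i)%N%:Z) = phi 1 + D *+ k.
  elim: k => [|k IH]; first by rewrite mul0n !addr0.
  have e : 1 + (k.+1 * i)%N%:Z - i%:Z = 1 + (k * i)%N%:Z by lia.
  by rewrite broken ?e ?ng1 // IH mulrSr /D !addrA.
have hp : D *+ p = phi p%:Z *+ i.
  apply: (@addrI _ (phi 1)); rewrite -hr -phiM mulnC pd //.
  by rewrite dvdzE /= dvdn_mull.
(* [q] is the order of [i] modulo [p], that is, the length of the orbit of 0. *)
have exq : exists q, (0 < q)%N && (p %| q * i)%N.
  by exists p; rewrite p0 dvdn_mulr.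
case: (ex_minnP exq) => q /andP[q0 pq] qmin.
have q2 : (1 < q)%N.
  rewrite ltn_neqAle q0 andbT; apply: contraTneq pq => <-.
  by rewrite mul1n; apply/negP => /(dvdn_leq i0); lia.
have nq k : (0 < k < q)%N -> ~~ (p %| k * i)%N.
  move=> /andP[k0 kq]; apply/negP => h.
  by have := qmin k; rewrite k0 h => /(_ isT); lia.
have hs k : (k.+1 < q)%N -> phi (k.+1 * i)%N%:Z = phi i%:Z + D *+ k.
  elim: k => [|k IH] kq; first by rewrite mul1n addr0.
  have e : (k.+2 * i)%N%:Z - i%:Z = (k.+1 * i)%N%:Z by lia.
  rewrite broken ?e ?dvdzE /= ?nq //; try lia.
  by rewrite IH ?(ltnW kq) // mulrSr /D !addrA.
have hq : phi (q * i)%N%:Z = D *+ q.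
  have [c ec] := dvdnP pq.
  apply/eqP; rewrite -subr_eq0; apply/eqP; apply: (@mulrn_eq0 _ p) => //.
  rewrite mulrnBl ec phiM -!mulrnA -ec mulnC [(q * p)%N]mulnC.
  by rewrite !mulrnA hp subrr.
(* The last point of the orbit is [- i] modulo [p], where oddness gives a second value of [phi];
   comparing the two leaves [2 E = 0]. *)
have e : (q.-2.+1 * i)%N%:Z = - i%:Z + (q * i)%N%:Z by nia.
have : phi (q.-2.+1 * i)%N%:Z = - phi i%:Z + D *+ q.
  by rewrite e pd ?dvdzE // podd hq.
rewrite hs; last lia.
have {2}-> : q = (q.-2 + 2)%N by lia.
rewrite mulrnDr mulr2n /D => h.
apply: (@mulrn_eq0 _ 2) => //.
move/eqP: h; rewrite -subr_eq0 => /eqP <-.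
by move: (_ *+ q.-2) => z; mxring.
Qed.
End BrokenShift.

End QuasiPeriodic.

(** * Odd quasi-periodic functions *)

Definition quasi_odd (H : zmodType) (phi : int -> H) (p : nat) : Prop :=
  [/\ phi 0 = 0, forall x, phi (- x) = - phi x
    & forall x, phi (x + p%:Z) = phi x + phi p%:Z].

(** Put [phi (k p + r) = f r + k S] for [0 < r < p], and [k S] for [r = 0]; the palindromic relation
    is what makes this odd. *)
Lemma quasi_odd_extension (H : zmodType) (f : int -> H) (p : nat) (S : H) :
  (1 < p)%N -> (forall i : int, 0 < i < p%:Z -> f i + f (p%:Z - i) = S) ->
  exists phi, [/\ quasi_odd phi p, phi p%:Z = S
    & forall i : int, 0 < i < p%:Z -> phi i = f i].
Proof.
move=> p1 palin.
pose b (r : int) := if r == 0 then 0 else f r.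
pose phi (x : int) := b (x %% p)%Z + S *~ (x %/ p)%Z.
have phiE (k r : int) : 0 <= r < p%:Z -> phi (k * p%:Z + r) = b r + S *~ k.
  move=> hr; rewrite /phi modzMDl divzMDl ?modz_small ?divz_small ?addr0 //; lia.
have decomp (x : int) : exists k r : int, x = k * p%:Z + r /\ 0 <= r < p%:Z.
  exists (x %/ p)%Z, (x %% p)%Z; rewrite -divz_eq; split=> //.
  by rewrite modz_ge0 ?ltz_pmod //; lia.
have phi_small r : 0 <= r < p%:Z -> phi r = b r.
  by move=> /(phiE 0); rewrite mul0r add0r mulr0z addr0.
have phiM k : phi (k * p%:Z) = S *~ k.
  by have := phiE k 0; rewrite !addr0 /b eqxx add0r => -> //; lia.
have phi0 : phi 0 = 0 by rewrite -(mul0r p%:Z) phiM mulr0z.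
have phip : phi p%:Z = S by rewrite -[p%:Z]mul1r phiM mulr1z.
exists phi; split=> //.
- split=> // [x|x]; have [k [r [-> hr]]] := decomp x.
    have [->|r0] := eqVneq r 0.
      by rewrite addr0 -mulNr !phiM mulrNz.
    have -> : - (k * p%:Z + r) = (- k - 1) * p%:Z + (p%:Z - r) by lia.
    rewrite !phiE //; last by lia.
    rewrite /b (negPf r0) ifF; last by lia.
    have -> : f (p%:Z - r) = S - f r.
      by rewrite -(palin r) ?[f r + _]addrC ?addrK //; lia.
    rewrite mulrzBr mulr1z mulrNz opprD [S - _]addrC -addrA.
    by rewrite [S + _]addrCA subrr addr0.
  have -> : k * p%:Z + r + p%:Z = (k + 1) * p%:Z + r by lia.
  by rewrite !phiE // phip mulrzDr mulr1z addrA.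
- move=> i hi; rewrite phi_small; last by lia.
  by rewrite /b ifF //; lia.
Qed.

Lemma quasi_odd_dvd (K : fieldType) (n : nat) (phi : int -> 'M[K]_n) (p : nat) :
  quasi_odd phi p -> forall d x : int, (p %| d)%Z -> phi (x + d) = phi x + phi d.
Proof. by move=> [phi0 _ per] d x; apply: additive_shift_dvd. Qed.

Lemma dvdz_nsmall (p : nat) (i : int) : 0 < i < p%:Z -> ~~ (p %| i)%Z.
Proof.
move=> /andP[i0 ip]; apply/negP => /dvdzP[k e]; rewrite e in i0 ip.
have [k0|k0] := lerP k 0; nia.
Qed.

Lemma residue (p : nat) (x : int) : (0 < p)%N ->
  exists i d : int, [/\ x = i + d, 0 <= i < p%:Z & (p %| d)%Z].
Proof.
move=> p0; exists (x %% p)%Z, ((x %/ p)%Z * p%:Z); split.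
- by rewrite addrC -divz_eq.
- by rewrite modz_ge0 ?ltz_pmod //; lia.
- exact: dvdz_mull.
Qed.

(** Multiples of [p] are left out because APAP does not constrain [f] there. *)
Definition agrees (V : Type) (m p : nat) (h psi : int -> V) : Prop :=
  forall j : int, 0 < j < m%:Z -> ~~ (p %| j)%Z -> h j = psi j.

Section Quasihomomorphisms.
Variables (K : fieldType) (n : nat).

Record rank1_quasihom (f : int -> 'M[K]_n) : Prop := {
  qh_sym : forall x, (f x)^T = f x;
  qh_rank : forall x y, (\rank (f (x + y) - f x - f y)%R <= 1)%N;
  qh_1 : f 1 = 0 }.

Variable f : int -> 'M[K]_n.
Hypothesis hf : rank1_quasihom f.

Lemma qh_diff_sym x : (fdiff f x)^T = fdiff f x.
Proof. by rewrite /fdiff linearB /= !(qh_sym hf). Qed.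

Lemma qh_diff_rank x : (\rank (fdiff f x) <= 1)%N.
Proof. by have := qh_rank hf x 1; rewrite (qh_1 hf) subr0. Qed.

End Quasihomomorphisms.

(** * Propagation from a finite block to all integers *)

(* [m] is the first index at which the span of the differences reaches
   dimension 3, and [W] is the span of the previous ones. *)
Section Extension.
Variables (K : fieldType) (n : nat).
Hypothesis hK : [pchar K] =i pred0.
Variables (f : int -> 'M[K]_n) (W : 'M[K]_n) (m p : nat) (phi : int -> 'M[K]_n).
Hypothesis hf : rank1_quasihom f.
Local Notation D := (fdiff f).
Hypothesis fW : forall j : int, 0 < j < m%:Z -> (f j <= W)%MS.
Hypothesis DW : ~~ (D (m%:Z - 1) <= W)%MS.
Hypothesis rank2 : forall A : 'M[K]_n,
  (forall j : int, 0 < j < m%:Z - 1 -> (D j <= A)%MS) -> (1 < \rank A)%N.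
Hypothesis rank3 : forall A : 'M[K]_n,
  (forall j : int, 0 < j < m%:Z -> (D j <= A)%MS) -> (2 < \rank A)%N.
Hypothesis p1 : (1 < p)%N.
Hypothesis pm : (p %| m)%N.
Hypothesis qo : quasi_odd phi p.
Hypothesis fphi : agrees m p f phi.
Hypothesis pmin : forall q psi, (1 < q < p)%N -> (q %| p)%N ->
  quasi_odd psi q -> ~ agrees m q f psi.

Let fs := qh_sym hf.
Let f1 := qh_1 hf.
Let phi0 : phi 0 = 0. Proof. by case: qo. Qed.
Let podd x : phi (- x) = - phi x. Proof. by case: qo => _ ->. Qed.
Let pd d x : (p %| d)%Z -> phi (x + d) = phi x + phi d.
Proof. exact: quasi_odd_dvd. Qed.
Let m1 : (1 < m)%N.
Proof.
rewrite ltnNge; apply/negP => hm.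
have := @rank2 0; rewrite mxrank0 => h.
have: (1 < 0)%N by apply: h => j; lia.
by [].
Qed.
Let pm' : (p <= m)%N. Proof. by apply: dvdn_leq => //; lia. Qed.
Let pmz : (p %| m%:Z)%Z. Proof. by rewrite dvdzE. Qed.
Let fphi_small (j : int) : 0 < j < p%:Z -> f j = phi j.
Proof. by move=> hj; apply: fphi; [lia | apply: dvdz_nsmall]. Qed.
Let phi1 : phi 1 = 0. Proof. by rewrite -fphi_small ?f1 //; lia. Qed.

(** The relation makes [phi] additive under [i] up to the rank-one defect [E]. If [i] and [p] are
    coprime, [phi 1 = 0] forces all values into [E], against [rank2]; otherwise [E = 0] and the gcd
    is a smaller period, against [pmin]. *)
Lemma no_broken_shift (i : nat) : (1 < i < p)%N ->
  ~ (forall j : int, 0 < j < m%:Z -> ~~ (p %| j - i%:Z)%Z ->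
      f j = f (i%:Z - 1) + phi (j - i%:Z)).
Proof.
move=> hi brk; pose E := D (i%:Z - 1).
have fi1 : f (i%:Z - 1) = phi i%:Z - E.
  by rewrite /E /fdiff subrK -fphi_small ?subKr //; lia.
have per x : phi (x + p%:Z) = phi x + phi p%:Z by case: qo.
have broken (j : int) : ~~ (p %| j)%Z -> ~~ (p %| j - i%:Z)%Z ->
    phi j = phi (j - i%:Z) + phi i%:Z - E.
  have [r [d [-> hr dp]]] := residue j (ltnW p1).
  rewrite addrAC !(rpredDr _ dp) => pr pri.
  have hr' : 0 < r < p%:Z.
    by rewrite lt0r; case: eqP pr hr => [-> | _ _ /andP[-> ->]]; rewrite ?dvdz0.
  rewrite !(pd _ dp) -(@fphi_small r) // brk //; last by lia.
  by rewrite fi1; mxring.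
have i0p : (0 < i < p)%N by lia.
have shift := broken_shift_gcd phi0 podd per broken.
have [g1|g1] := leqP (gcdn p i) 1.
  have {}g1 : gcdn p i = 1%N by apply/eqP; rewrite eqn_leq g1 gcdn_gt0; lia.
  rewrite g1 in shift.
  have natE (k : nat) : (phi k%:Z <= E)%MS.
    elim: k => [|k IH]; first by rewrite phi0 sub0mx.
    have := shift k%:Z; rewrite phi1 subr0 => h.
    rewrite -addn1 PoszD (_ : phi _ = (phi (k%:Z + 1) - phi k%:Z) + phi k%:Z).
      exact: addmx_sub.
    by rewrite subrK.
  have phiE (x : int) : (phi x <= E)%MS.
    by case: x => k //; rewrite NegzE podd eqmx_opp.
  have fE (j : int) : 0 < j < m%:Z -> (f j <= E)%MS.
    move=> hj; have [pj|pj] := boolP (p %| j)%Z; last by rewrite fphi.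
    rewrite brk //; first by rewrite fi1 !addmx_sub ?eqmx_opp.
    rewrite -[j - _]opprB rpredN rpredBr //.
    by apply: dvdz_nsmall; lia.
  have := @rank2 E; rewrite ltnNge (qh_diff_rank hf) => h.
  suff : false by [].
  apply: h => j hj; rewrite addmx_sub ?eqmx_opp ?fE //; lia.
have E0 := broken_shift_defect0 hK phi0 podd per i0p broken g1.
rewrite E0 in shift.
apply: (@pmin (gcdn p i) phi).
- by rewrite g1 /=; have := dvdn_leq _ (dvdn_gcdr p i); lia.
- exact: dvdn_gcdl.
- by split=> //; apply: additive_shift0.
- move=> j hj gj; apply: fphi => //; apply: contra gj; apply: dvdz_trans.
  by rewrite dvdzE dvdn_gcdl.
Qed.

Lemma phi_submx x : (phi x <= W)%MS.
Proof.
have natE (k : nat) : (phi (k%:Z * p%:Z) <= W)%MS.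
  elim: k => [|k IH]; first by rewrite mul0r phi0 sub0mx.
  rewrite intS mulrDl mul1r pd ?dvdz_mull // addmx_sub //.
  have -> : phi p%:Z = phi (p%:Z - 1).
    by rewrite [_ - 1]addrC pd ?dvdzz // podd phi1 oppr0 add0r.
  by rewrite -fphi_small ?fW //; lia.
have [i [d [-> hi /dvdzP[k ->]]]] := residue x (ltnW p1).
rewrite pd ?dvdz_mull // addmx_sub //.
  have [->|i0] := eqVneq i 0; first by rewrite phi0 sub0mx.
  by rewrite -fphi_small ?fW //; lia.
by case: k => k //; rewrite NegzE mulNr podd eqmx_opp.
Qed.

(* Stated for [h] besides [f] itself because it is also applied to a
   reflection of [f], which carries the conclusion to the negative side. *)
Lemma quasi_odd_propagates (h : int -> 'M[K]_n) :
  (forall x, (h x)^T = h x) ->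
  (forall x j : int, 0 < j <= m%:Z -> (\rank (h (x + j) - h x - f j)%R <= 1)%N) ->
  agrees m p h phi -> forall x : int, 0 < x -> ~~ (p %| x)%Z -> h x = phi x.
Proof.
move=> hs hr ha x x0 px.
have [N] : exists N : nat, x <= N%:Z by exists `|x|%N; lia.
elim: N x x0 px => [|N IH] x x0 px xN; first by lia.
have [xm|xm] := ltrP x m%:Z; first by apply: ha => //; lia.
have {}xm : m%:Z < x.
  by rewrite lt_neqAle xm andbT; apply: contraNneq px => <-.
have win (j : int) : 0 < j <= m%:Z -> (\rank (h x - h (x - j) - f j)%R <= 1)%N.
  by move=> /(hr (x - j)); rewrite subrK.
have hx (j : int) : 0 < j < x -> ~~ (p %| x - j)%Z -> h (x - j) = phi (x - j).
  by move=> hj pj; apply: IH => //; lia.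
have [i [d [ex hi dp]]] := residue x (ltnW p1).
have i0 : i != 0.
  by apply: contraNneq px => i0; rewrite ex i0 add0r.
have ndvd1 : ~~ (p %| 1)%Z by apply: dvdz_nsmall; lia.
(* For [x = 1] modulo [p], the value at [x - 1] is unknown. Longer windows show that a nonzero error
   [Q] contains every [D j], hence has rank at least 3, yet [Q - D 1] and [D 1] have rank at most
   1. *)
have [i1|i1] := eqVneq i 1.
  have exd : x = d + 1 by rewrite ex i1 addrC.
  have ph x' : phi (x' + d) = phi x' + phi d by apply: pd.
  have hd y : ~~ (p %| y)%Z -> - m%:Z < y < 1 -> h (d + y) = phi d + phi y.
    move=> py hy; have e : d + y = x - (1 - y) by lia.
    rewrite e hx -?e; first by rewrite addrC ph addrC.
      by lia.
    by rewrite rpredDl.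
  have phix : phi x = phi d by rewrite exd addrC ph phi1 add0r.
  apply/eqP; rewrite phix -subr_eq0; apply/negPn/negP => Q0.
  set Q := h x - phi d in Q0.
  have Qs : Q^T = Q.
    rewrite /Q; have <- : h (d - 1) = phi d.
      by rewrite hd ?podd ?phi1 ?oppr0 ?addr0 ?rpredN //; lia.
    by rewrite linearB /= !hs.
  have QD (j : int) : 0 < j < m%:Z -> ~~ (p %| j)%Z -> (\rank (Q - D j)%R <= 1)%N.
    move=> hj pj; have := @win (j + 1).
    have -> : x - (j + 1) = d - j by lia.
    rewrite hd ?rpredN // ?podd -?(@fphi j) //; last by lia.
    rewrite (_ : _ - _ - f (j + 1) = Q - D j);
      last by rewrite /Q /fdiff; mxring.
    by apply; lia.
  have DQ (j : int) : 0 < j < m%:Z -> ~~ (p %| j)%Z -> (D j <= Q)%MS.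
    move=> hj pj; apply: sym_sub_rank1_submx => //.
    - exact: qh_diff_sym.
    - exact: qh_diff_rank.
    - exact: QD.
  have : (2 < \rank Q)%N.
    apply: rank3 => j hj; have [pj|pj] := boolP (p %| j)%Z; last exact: DQ.
    have pj1 : ~~ (p %| j - 1)%Z by rewrite rpredDl // rpredN.
    have j1 : j != 1 by apply: contraTneq pj => ->.
    have jm : j + 1 != m%:Z.
      by apply: contraNneq ndvd1 => e; rewrite -(rpredDl _ pj) e.
    (* At a multiple [j] of [p], [f (j + 1)] and [f (j - 1)] both equal [phi j]. *)
    have -> : D j = - D (j - 1).
      rewrite /fdiff subrK opprB (@fphi (j + 1)) ?(@fphi (j - 1)) ?rpredDl //; try lia.
      by rewrite ![j + _]addrC !pd // podd phi1 oppr0.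
    rewrite eqmx_opp DQ //; lia.
  have Q1 : (\rank (Q - D 1)%R <= 1)%N by apply: QD; rewrite ?ltz_nat.
  rewrite -(subrK (D 1) Q); apply/negP; rewrite -leqNgt.
  apply: leq_trans (mxrank_add _ _) _.
  exact: (leq_add Q1 (qh_diff_rank hf 1)).
have i2 : 1 < i < p%:Z by lia.
have nd1 : ~~ (p %| x - 1)%Z by rewrite ex addrAC rpredDr // dvdz_nsmall //; lia.
pose R := h x - h (x - 1).
have Rs : R^T = R by rewrite linearB /= !hs.
have Rr : (\rank R <= 1)%N by have := @win 1; rewrite f1 subr0; apply; lia.
have hx1 : h (x - 1) = f (i - 1) + phi d.
  by rewrite hx //; [rewrite ex addrAC pd // fphi_small //; lia | lia].
have hxi : phi x = f i + phi d by rewrite ex pd // fphi_small //; lia.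
have XR : h x - phi x = R - D (i - 1).
  by rewrite hxi /R hx1 /fdiff subrK; mxring.
(* If [R] lies in [W], so does the error at [x], and the window of length [m] adds only
   [- D (m - 1)], which leaves [W]. *)
have [RW|RW] := boolP (R <= W)%MS.
  apply/eqP; rewrite -subr_eq0; apply/eqP.
  apply: (@sym_add_rank1_eq0 _ _ W _ (- D (m%:Z - 1))).
  - by rewrite XR linearB /= Rs (qh_diff_sym hf).
  - by rewrite linearN /= (qh_diff_sym hf).
  - by rewrite mxrank_opp (qh_diff_rank hf).
  - have := @win m%:Z; rewrite hx ?rpredBr //; last by lia.
    rewrite [phi (x - _)]pd ?rpredN //. rewrite (podd m%:Z) => w.
    rewrite /fdiff subrK (_ : f (m%:Z - 1) = phi m%:Z).
      rewrite (_ : _ + _ = h x - (phi x - phi m%:Z) - f m%:Z); last by mxring.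
      by apply: w; lia.
    rewrite fphi; [|lia|by rewrite rpredBl // rpredN; apply: dvdz_nsmall; lia].
    by rewrite addrC pd // podd phi1 oppr0 add0r.
  - rewrite XR addmx_sub // eqmx_opp /fdiff subrK addmx_sub ?eqmx_opp ?fW //; lia.
  - by rewrite eqmx_opp.
(* Otherwise [R] itself leaves [W] and makes all shorter windows exact: a broken shift by [i]. *)
case: (@no_broken_shift `|i|%N); first by lia.
have -> : `|i|%N%:Z = i by lia.
move=> j hj pji.
have xj : x - j = - (j - i) + d by rewrite ex opprB addrAC.
have pxj : ~~ (p %| x - j)%Z by rewrite xj rpredDr // rpredN.
have hxj : h (x - j) = phi d - phi (j - i).
  by rewrite hx //; [rewrite xj (pd _ dp) podd addrC | lia].
pose Y := h (x - 1) - h (x - j) - f j.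
have Y0 : Y = 0.
  apply: (@sym_add_rank1_eq0 _ _ W _ R) => //.
  - by rewrite !linearB /= !hs fs.
  - rewrite (_ : Y + R = h x - h (x - j) - f j); last by rewrite /Y /R; mxring.
    by apply: win; lia.
  - rewrite /Y hx1 hxj.
    by rewrite !(addmx_sub, eqmx_opp) ?phi_submx ?fW //; lia.
rewrite -[f j]addr0 -Y0 /Y hx1 hxj; mxring.
Qed.

End Extension.

Lemma nat_least (P : nat -> Prop) :
  (exists k, P k) -> exists2 k, P k & forall q, (q < k)%N -> ~ P q.
Proof.
case=> k; elim/ltn_ind: k => k IH Pk.
have [[q [qk Pq]]|no] := classic (exists q, (q < k)%N /\ P q).
  exact: IH Pq.
by exists k => // q qk Pq; apply: no; exists q.
Qed.

(** * Periods and spans of differences *)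

Section Sides.
Variables (K : fieldType) (n : nat).
Hypothesis hK : [pchar K] =i pred0.

(** The single [W] later yields both the dimension bound and the rank bound. *)
Definition has_period (f : int -> 'M[K]_n) (p : nat) : Prop :=
  [/\ (1 < p)%N,
      exists2 phi, quasi_odd phi p & forall x : int, ~~ (p %| x)%Z -> f x = phi x
    & exists2 W : 'M[K]_n, (\rank W <= 2)%N &
        forall j : int, 0 < j < p%:Z - 1 -> (fdiff f j <= W)%MS].

Definition pos_span (f : int -> 'M[K]_n) (k : nat) : 'M[K]_n :=
  (\sum_(i < k) fdiff f i.+1%:Z)%MS.

Lemma pos_span_sub f (k : nat) (j : int) :
  0 < j < k.+1%:Z -> (fdiff f j <= pos_span f k)%MS.
Proof.
move=> hj; have jk : (`|j|.-1 < k)%N by lia.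
apply: (@sumsmx_sup _ _ (Ordinal jk)) => //=.
by rewrite (_ : `|j|.-1.+1%:Z = j) //; lia.
Qed.

Lemma pos_span_subP f (k : nat) (A : 'M[K]_n) :
  (forall j : int, 0 < j < k.+1%:Z -> (fdiff f j <= A)%MS) ->
  (pos_span f k <= A)%MS.
Proof.
by move=> h; apply/sumsmx_subP => i _; apply: h; have := ltn_ord i; lia.
Qed.

(** * Three dimensions at positive indices *)

Section Positive.
Variable f : int -> 'M[K]_n.
Hypothesis hf : rank1_quasihom f.
Local Notation D := (fdiff f).
Let fs := qh_sym hf.
Let fr := qh_rank hf.
Let f1 := qh_1 hf.

Lemma qh_sub_of_diff (W : 'M[K]_n) (m : int) :
  (forall j : int, 0 < j < m -> (D j <= W)%MS) ->
  forall j : int, 0 < j <= m -> (f j <= W)%MS.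
Proof.
move=> hD j hj.
have {hj} : exists k : nat, j = k.+1%:Z /\ k.+1%:Z <= m by exists `|j|.-1; lia.
case=> k [-> {j}]; elim: k => [|k IH] km; first by rewrite f1 sub0mx.
rewrite (_ : f _ = f k.+1%:Z + D k.+1%:Z); first by rewrite addmx_sub ?IH ?hD //; lia.
by rewrite /fdiff [RHS]addrC subrK; congr f; lia.
Qed.

Theorem pos_side_period : (exists k, (2 < \rank (pos_span f k))%N) ->
  exists p, has_period f p.
Proof.
move=> hk; case: (ex_minnP hk) => [[|k]] rk kmin.
  by rewrite /pos_span big_ord0 mxrank0 in rk.
pose W := pos_span f k; pose m := k.+2.
have spanS : pos_span f k.+1 = (W + D k.+1%:Z)%MS by rewrite /pos_span big_ord_recr.
have rW : (\rank W <= 2)%N.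
  by rewrite leqNgt; apply/negP => /kmin; rewrite ltnn.
have rW2 : (1 < \rank W)%N.
  have := mxrank_adds_leqif W (D k.+1%:Z); rewrite -spanS => -[h _].
  have := leq_trans rk h; have := qh_diff_rank hf k.+1%:Z; lia.
have DW : ~~ (D (m%:Z - 1) <= W)%MS.
  have -> : m%:Z - 1 = k.+1%:Z by lia.
  apply: contraTN rk => DW; rewrite -leqNgt; apply: leq_trans rW.
  by rewrite mxrankS // spanS addsmx_sub submx_refl.
have WD (j : int) : 0 < j < m%:Z - 1 -> (D j <= W)%MS.
  by move=> hj; apply: pos_span_sub; lia.
have fW (j : int) : 0 < j < m%:Z -> (f j <= W)%MS.
  by move=> hj; apply: (qh_sub_of_diff WD); lia.
have rank2 (A : 'M[K]_n) :
    (forall j : int, 0 < j < m%:Z - 1 -> (D j <= A)%MS) -> (1 < \rank A)%N.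
  move=> h; apply: leq_trans rW2 _; apply/mxrankS/pos_span_subP => j hj.
  by apply: h; lia.
have rank3 (A : 'M[K]_n) :
    (forall j : int, 0 < j < m%:Z -> (D j <= A)%MS) -> (2 < \rank A)%N.
  by move=> h; apply: leq_trans rk _; apply/mxrankS/pos_span_subP.
(* The defect lies in [W], and adding [D (m - 1)] turns it into the rank condition at
   [(i, m - i)]. *)
have palin (i : int) : 0 < i < m%:Z -> f i + f (m%:Z - i) = f (m%:Z - 1).
  move=> hi; apply/esym/eqP; rewrite -subr_eq0; apply/eqP.
  apply: (@sym_add_rank1_eq0 _ _ W _ (D (m%:Z - 1))) => //.
  - by rewrite !(linearB, linearD) /= !fs.
  - exact: qh_diff_sym.
  - exact: qh_diff_rank.
  - have := fr i (m%:Z - i); rewrite [i + _]addrC subrK => h.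
    rewrite (_ : _ + _ = f m%:Z - f i - f (m%:Z - i)) //.
    by rewrite /fdiff subrK; mxring.
  - by rewrite addmx_sub ?fW ?eqmx_opp ?addmx_sub ?fW //; lia.
have [p [p1 pm [phi qo fphi]] pmin] : exists2 p,
    [/\ (1 < p)%N, (p %| m)%N & exists2 phi, quasi_odd phi p & agrees m p f phi] &
    forall q, (q < p)%N ->
    ~ [/\ (1 < q)%N, (q %| m)%N & exists2 phi, quasi_odd phi q & agrees m q f phi].
  (* [m] itself is a candidate period, so a least one exists. *)
  apply: nat_least; exists m; split=> //.
  have [phi [qo _ phif]] := quasi_odd_extension (isT : (1 < m)%N) palin.
  by exists phi => // j hj _; rewrite phif.
have pmin' q psi : (1 < q < p)%N -> (q %| p)%N -> quasi_odd psi q -> ~ agrees m q f psi.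
  move=> /andP[q1 qp] qdp qq aq; apply: (pmin q qp); split=> //.
    exact: dvdn_trans pm.
  by exists psi.
have ext := quasi_odd_propagates hK hf fW DW rank2 rank3 p1 pm qo fphi pmin'.
have pmz : (p %| m%:Z)%Z by rewrite dvdzE.
have pd := quasi_odd_dvd qo.
have [phi0 podd _] := qo.
have phi1 : phi 1 = 0.
  by rewrite -fphi ?f1 //; apply: dvdz_nsmall; lia.
have phim : phi m%:Z = f (m%:Z - 1).
  rewrite fphi; [|lia|by rewrite rpredBl //; apply: dvdz_nsmall; lia].
  by rewrite addrC pd // podd phi1 oppr0 add0r.
have phiB x : phi (m%:Z - x) = phi m%:Z - phi x by rewrite addrC pd // podd addrC.
have fpos : forall x : int, 0 < x -> ~~ (p %| x)%Z -> f x = phi x.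
  by apply: ext => // x j _; apply: fr.
(* This reflection about the block satisfies the same window conditions and agrees with [phi] on the
   block; at [m - x] it reaches every [x <= 0]. *)
have fneg : forall x : int, 0 < x -> ~~ (p %| x)%Z -> phi m%:Z - f (m%:Z - x) = phi x.
  apply: (ext (fun x => phi m%:Z - f (m%:Z - x))).
  - by move=> x; rewrite phim linearB /= !fs.
  - move=> x j _; have := fr (m%:Z - (x + j)) j.
    rewrite (_ : m%:Z - (x + j) + j = m%:Z - x); last by lia.
    rewrite (_ : _ - _ - f j = phi m%:Z - f (m%:Z - (x + j)) -
      (phi m%:Z - f (m%:Z - x)) - f j) //; mxring.
  - move=> x hx px; rewrite fphi ?phiB ?subKr //; first by lia.
    by rewrite rpredBl.
exists p; split=> //.
  exists phi => // x px; have [x0|x0] := ltrP 0 x; first exact: fpos.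
  have := fneg (m%:Z - x); rewrite phiB subKr => h.
  by apply/oppr_inj/(addrI (phi m%:Z))/h; [lia | rewrite rpredBl //].
exists W => // j hj; apply: WD.
by have := dvdn_leq _ pm; lia.
Qed.

End Positive.

(** * Reflection of the integers *)

Definition rev (f : int -> 'M[K]_n) (x : int) : 'M[K]_n := f (- x).

Lemma rank1_quasihom_rev f : rank1_quasihom f -> f (- 1) = 0 -> rank1_quasihom (rev f).
Proof.
move=> hf fN1; split; [by move=> x; apply: (qh_sym hf) | | exact: fN1].
by move=> x y; rewrite /rev opprD; apply: (qh_rank hf).
Qed.

(** Off the multiples of [p], oddness makes reflection a mere change of sign. *)
Lemma has_period_rev f p : has_period (rev f) p -> has_period f p.
Proof.
case=> p1 [phi qo fphi] [W rW hW]; have [phi0 podd per] := qo.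
have fE x : ~~ (p %| x)%Z -> f x = - phi x.
  by move=> px; rewrite -podd -fphi ?rpredN // /rev opprK.
split=> //.
  exists (fun x => - phi x) => //; split=> [|x|x]; first by rewrite phi0 oppr0.
    by rewrite podd.
  by rewrite per opprD.
exists W => // j hj.
have hd i : 0 < i < p%:Z -> f i = - rev f i.
  by move=> hi; rewrite fE ?fphi ?dvdz_nsmall.
rewrite (_ : fdiff f j = - fdiff (rev f) j) ?eqmx_opp ?hW //.
by rewrite /fdiff !hd ?opprB 1?addrC ?opprK //; lia.
Qed.

(** The condition at [(j + 1, -1)] bounds the rank of [f (-1) + fdiff f j] by 1. A nonzero [f (-1)]
    would thus contain all differences while having rank at most 2. *)
Lemma qh_N1 f : rank1_quasihom f ->
  (forall A : 'M[K]_n,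
     (forall j : int, (j != 0) && (j != -1) -> (fdiff f j <= A)%MS) ->
     (2 < \rank A)%N) ->
  f (- 1) = 0.
Proof.
move=> hf span3; apply/eqP/negPn/negP => f0.
have fr := qh_rank hf.
have rD j : (\rank (f (- 1) + fdiff f j)%R <= 1)%N.
  have := fr (j + 1) (- 1); rewrite addrK -mxrank_opp.
  by rewrite (_ : - _ = f (- 1) + fdiff f j) // /fdiff; mxring.
have := span3 (f (- 1)); rewrite ltnNge => h.
suff : ~~ (\rank (f (- 1)%R) <= 2)%N.
  rewrite -[f (- 1)](addrK (fdiff f 1)) => /negP; apply.
  apply: leq_trans (mxrank_add _ _) _; rewrite mxrank_opp.
  exact: leq_add (rD 1) (qh_diff_rank hf 1).
apply: h => j _; rewrite -eqmx_opp; apply: sym_sub_rank1_submx => //.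
- by rewrite linearN /= qh_diff_sym.
- exact: qh_sym.
- by rewrite mxrank_opp qh_diff_rank.
- by rewrite opprK.
Qed.

(** Choose [k] of least codimension: enlarging the span to reach [j] cannot raise its rank. *)
Lemma pos_span_stable f :
  exists k, forall j : int, 0 < j -> (fdiff f j <= pos_span f k)%MS.
Proof.
have [d [k kd] dmin] : exists2 d, (exists k, (n - \rank (pos_span f k))%N = d) &
    forall q, (q < d)%N -> ~ (exists k, (n - \rank (pos_span f k))%N = q).
  by apply: nat_least; exists (n - \rank (pos_span f 0))%N, 0%N.
exists k => j j0; pose k' := maxn k `|j|%N.
have sub : (pos_span f k <= pos_span f k')%MS.
  by apply: pos_span_subP => i hi; apply: pos_span_sub; lia.
have jk : (fdiff f j <= pos_span f k')%MS by apply: pos_span_sub; lia.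
have [_ ] := mxrank_leqif_eq sub.
rewrite eqn_leq (mxrankS sub) /= => e; apply: submx_trans jk _.
suff : (\rank (pos_span f k') <= \rank (pos_span f k))%N.
  by rewrite e => /andP[].
rewrite leqNgt; apply/negP => lt; apply: (dmin (n - \rank (pos_span f k'))%N).
  by rewrite -kd ltn_sub2l // (leq_trans lt) ?rank_leq_row.
by exists k'.
Qed.

(** * Exact relations at the first exit index *)

(* Here [j - 1] is the first index at which the negative side leaves the span
   [U] of the positive side. *)
Section OneSide.
Variables (f g : int -> 'M[K]_n) (U : 'M[K]_n) (j : nat).
Hypothesis hf : rank1_quasihom f.
Hypothesis hg : rank1_quasihom g.
Hypothesis fg : forall x, g x = f (- x).
Hypothesis j1 : (1 < j)%N.
Hypothesis fU : forall i : int, 0 < i -> (fdiff f i <= U)%MS.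
Hypothesis gU : forall i : int, 0 < i < j%:Z - 1 -> (fdiff g i <= U)%MS.
Hypothesis gNU : ~~ (fdiff g (j%:Z - 1) <= U)%MS.

Let fU' (x : int) : 0 < x -> (f x <= U)%MS.
Proof.
by move=> x0; apply: (@qh_sub_of_diff f hf U x) => [i hi|]; [apply: fU|]; lia.
Qed.
Let gU' (i : int) : 0 < i < j%:Z -> (g i <= U)%MS.
Proof. by move=> hi; apply: (qh_sub_of_diff hg gU); lia. Qed.
Let gj : g j%:Z = g (j%:Z - 1) + fdiff g (j%:Z - 1).
Proof. by rewrite /fdiff subrK addrC subrK. Qed.
Let fs := qh_sym hf.
Let gs := qh_sym hg.

(** Used on rank conditions involving [g j]: splitting off the difference at [j - 1] leaves a [Y]
    supported in [U]. *)
Let vanish Y : Y^T = Y -> (Y <= U)%MS ->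
  (\rank (Y - fdiff g (j%:Z - 1))%R <= 1)%N -> Y = 0.
Proof.
move=> Ys YU rY; apply: (sym_add_rank1_eq0 Ys _ _ rY YU).
- by rewrite linearN /= qh_diff_sym.
- by rewrite mxrank_opp qh_diff_rank.
- by rewrite eqmx_opp.
Qed.

Lemma one_side_shift (x : int) : 0 < x -> f (x + j%:Z) = f x - g (j%:Z - 1).
Proof.
move=> x0; apply/eqP; rewrite eq_sym -subr_eq0; apply/eqP/vanish.
- by rewrite !linearB /= !fs gs.
- by rewrite !addmx_sub ?eqmx_opp ?fU' ?gU' //; lia.
- have := qh_rank hf (x + j%:Z) (- j%:Z); rewrite addrK -fg gj => h.
  by rewrite (_ : _ - _ = f x - f (x + j%:Z) -
    (g (j%:Z - 1) + fdiff g (j%:Z - 1))); last by mxring.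
Qed.

Lemma one_side_palin (i : int) : 0 < i < j%:Z -> g i + g (j%:Z - i) = g (j%:Z - 1).
Proof.
move=> hi; apply/eqP; rewrite -subr_eq0; apply/eqP/vanish.
- by rewrite !(linearB, linearD) /= !gs.
- by rewrite !addmx_sub ?eqmx_opp ?gU' //; lia.
- have := qh_rank hg i (j%:Z - i); rewrite [i + _]addrC subrK gj -mxrank_opp => h.
  by rewrite (_ : _ - _ = - (g (j%:Z - 1) + fdiff g (j%:Z - 1) - g i -
    g (j%:Z - i))); last by mxring.
Qed.

Lemma one_side_odd (i : int) : 0 < i < j%:Z -> f i = - g i.
Proof.
move=> hi; have pal := one_side_palin hi.
have : g (j%:Z - i) - g (j%:Z - 1) - f i = 0.
  apply: vanish.
  - by rewrite !linearB /= !gs fs.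
  - by rewrite !addmx_sub ?eqmx_opp ?fU' ?gU' //; lia.
  - have := qh_rank hf (- j%:Z) i.
    rewrite (_ : - j%:Z + i = - (j%:Z - i)) -?fg ?gj; last by lia.
    move=> h; rewrite (_ : _ - _ = g (j%:Z - i) -
      (g (j%:Z - 1) + fdiff g (j%:Z - 1)) - f i) //.
    by mxring.
rewrite -pal => /eqP; rewrite subr_eq0 => /eqP <-.
by rewrite opprD addrCA subrr addr0.
Qed.

End OneSide.

Lemma two_sides_period f (U V : 'M[K]_n) : rank1_quasihom f -> f (- 1) = 0 ->
  (\rank U <= 2)%N ->
  (forall i : int, 0 < i -> (fdiff f i <= U)%MS) ->
  (forall i : int, 0 < i -> (fdiff (rev f) i <= V)%MS) ->
  (exists2 i : int, 0 < i & ~~ (fdiff f i <= V)%MS) ->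
  (exists2 i : int, 0 < i & ~~ (fdiff (rev f) i <= U)%MS) ->
  exists p, has_period f p.
Proof.
move=> hf fN1 rU fU gV nfV ngU; have hg := rank1_quasihom_rev hf fN1.
have least (h : int -> 'M[K]_n) (A : 'M[K]_n) :
    (exists2 i : int, 0 < i & ~~ (fdiff h i <= A)%MS) ->
    exists j : nat, [/\ (1 < j)%N,
      forall i : int, 0 < i < j%:Z - 1 -> (fdiff h i <= A)%MS
      & ~~ (fdiff h (j%:Z - 1) <= A)%MS].
  case=> i i0 hi.
  have [k hk kmin] : exists2 k : nat, ~~ (fdiff h k.+1%:Z <= A)%MS &
      forall q, (q < k)%N -> ~ ~~ (fdiff h q.+1%:Z <= A)%MS.
    by apply: nat_least; exists `|i|.-1; rewrite (_ : _.+1%:Z = i) //; lia.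
  exists k.+2; rewrite (_ : k.+2%:Z - 1 = k.+1%:Z); last by lia.
  split; [by [] | move=> l hl | exact: hk].
  apply/negPn/negP => hn; apply: (kmin `|l|.-1); first by lia.
  by rewrite (_ : _.+1%:Z = l) //; lia.
have [j [j1 gU gNU]] := least (rev f) U ngU.
have [j' [j'1 fV fNV]] := least f V nfV.
have revK x : f x = rev f (- x) by rewrite /rev opprK.
have revE x : rev f x = f (- x) by [].
have odd := one_side_odd hf hg revE j1 fU gU gNU.
have odd' := one_side_odd hg hf revK j'1 gV fV fNV.
(* Before the larger exit index [f] and [rev f] are opposite, so the other side cannot exit
   earlier. *)
have jj' : j = j'.
  apply/eqP; rewrite eqn_leq; apply/andP; split; rewrite leqNgt; apply/negP => lt.
    case/negP: fNV; rewrite (_ : fdiff f _ = - fdiff (rev f) (j'%:Z - 1)).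
      by rewrite eqmx_opp gV //; lia.
    by rewrite /fdiff !odd; [mxring | lia | lia].
  case/negP: gNU; rewrite (_ : fdiff _ _ = - fdiff f (j%:Z - 1)).
    by rewrite eqmx_opp fU //; lia.
  by rewrite /fdiff !odd'; [mxring | lia | lia].
subst j'.
have shift := one_side_shift hf hg revE j1 fU gU gNU.
have shift' := one_side_shift hg hf revK j1 gV fV fNV.
have palin (i : int) : 0 < i < j%:Z -> f i + f (j%:Z - i) = - rev f (j%:Z - 1).
  move=> hi; rewrite -(one_side_palin hg j1 gU gNU hi) !odd ?opprD //; lia.
have [phi [qo phij phif]] := quasi_odd_extension j1 palin.
have [phi0 podd per] := qo.
(* Both sides start opposite on the block, and shifting by [j] changes them by opposite amounts. *)
have both (N : nat) (x : int) : 0 < x <= N%:Z -> ~~ (j %| x)%Z ->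
    f x = phi x /\ rev f x = - phi x.
  elim: N x => [|N IH] x hx jx; first by lia.
  have [xj|xj] := ltrP x j%:Z.
    have hx' : 0 < x < j%:Z by lia.
    by rewrite phif // odd // opprK.
  have xj' : j%:Z != x by apply: contraNneq jx => <-.
  have jxj : ~~ (j %| x - j%:Z)%Z by rewrite rpredBr ?dvdzz.
  have hxj : 0 < x - j%:Z <= N%:Z by lia.
  have [fx gx] := IH _ hxj jxj.
  have -> : x = x - j%:Z + j%:Z by rewrite subrK.
  have fj : f (j%:Z - 1) = - rev f (j%:Z - 1) by apply: odd; lia.
  by rewrite shift ?shift' ?fx ?gx ?per ?phij ?fj ?opprD //; lia.
exists j; split=> //; last by exists U => // i hi; apply: fU; lia.
exists phi => // x jx.
have x0 : x != 0 by apply: contraNneq jx => ->; rewrite dvdz0.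
have [xp|xn] := ltrP 0 x.
  have hx : 0 < x <= `|x|%N%:Z by lia.
  by have [] := both _ _ hx jx.
have hx : 0 < - x <= `|x|%N%:Z by lia.
have jNx : ~~ (j %| - x)%Z by rewrite rpredN.
by have [_] := both _ _ hx jNx; rewrite /rev opprK podd opprK.
Qed.

Theorem rank1_quasihom_period f : rank1_quasihom f ->
  (forall A : 'M[K]_n,
     (forall j : int, (j != 0) && (j != -1) -> (fdiff f j <= A)%MS) ->
     (2 < \rank A)%N) ->
  exists p, has_period f p.
Proof.
move=> hf span3; have fN1 := qh_N1 hf span3.
have hg := rank1_quasihom_rev hf fN1.
have [kf fU] := pos_span_stable f.
have [kg gV] := pos_span_stable (rev f).
have [rU|rU] := leqP (\rank (pos_span f kf)) 2; last first.
  by apply: pos_side_period => //; exists kf.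
have [rV|rV] := leqP (\rank (pos_span (rev f) kg)) 2; last first.
  have [|p hp] := pos_side_period hg; first by exists kg.
  by exists p; apply: has_period_rev.
(* Indices [j < -1] become positive indices of [rev f]. So if one span contained the other, it would
   carry every difference off 0 and -1 with rank at most 2. *)
have fdiff_neg j : fdiff f j = - fdiff (rev f) (- j - 1).
  by rewrite /fdiff /rev subrK opprK opprB opprD !opprK.
apply: (two_sides_period hf fN1 rU fU gV); apply: NNPP => no.
  have := span3 (pos_span (rev f) kg); rewrite ltnNge rV => /(_ _)/negP; apply=> // j.
  have [j0 _|j0 /andP[? ?]] := ltrP 0 j.
    by apply/negPn/negP => h; apply: no; exists j.
  by rewrite fdiff_neg eqmx_opp gV //; lia.
have := span3 (pos_span f kf); rewrite ltnNge rU => /(_ _)/negP; apply=> // j.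
have [j0 _|j0 /andP[? ?]] := ltrP 0 j; first exact: fU.
rewrite fdiff_neg eqmx_opp; apply/negPn/negP => h; apply: no.
by exists (- j - 1) => //; lia.
Qed.

(** Each clause involves [f] only off the multiples of [p]; in the second one, the value at [j]
    telescopes away. *)
Lemma has_period_apap f p : f 1 = 0 -> has_period f p -> apap (fdiff f) p.
Proof.
move=> f1 [p1 [phi qo fphi] _]; have [phi0 podd per] := qo.
have pd := quasi_odd_dvd qo.
have phi1 : phi 1 = 0 by rewrite -fphi ?f1 //; apply: dvdz_nsmall; lia.
split=> //.
- move=> i; rewrite !eqz_mod_dvd subr0 opprK => i1 i0.
  rewrite /fdiff addrAC !fphi ?(rpredDr _ (dvdzz p)) // !per.
  by rewrite opprD addrACA subrr addr0.
- move=> j pj; have nd1 : ~~ (p %| 1)%Z by apply: dvdz_nsmall; lia.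
  rewrite /fdiff subrK addrC addrA subrK !fphi ?(rpredDl _ pj) ?rpredN //.
  by rewrite ![j + _]addrC !pd // podd phi1 oppr0 subrr.
- move=> i hi; rewrite /fdiff !fphi; try by apply: dvdz_nsmall; lia.
  have -> : p%:Z - 1 - i + 1 = - i + p%:Z by lia.
  have -> : p%:Z - 1 - i = - (i + 1) + p%:Z by lia.
  by rewrite !per !podd; mxring.
Qed.

End Sides.

Theorem theorem6p1 (K : fieldType) (hK : [pchar K] =i pred0) (n : nat)
    (f : int -> 'M[K]_n)
    (hsym : forall x : int, f x \is symmetricmx)
    (hrk : forall x y : int, (\rank (f (x + y) - f x - f y)%R <= 1)%N)
    (hf1 : f 1 = 0)
    (V : {vspace 'cV[K]_n})
    (hS : is_sumv (fun i : int => (i != 0) && (i != -1))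
                  (fun i : int => colspace (fdiff f i)) V)
    (hdim : (3 <= \dim V)%N) :
  exists p : nat,
    [/\ apap (fdiff f) p,
        (\dim (\sum_(1 <= i < p.-1) colspace (fdiff f i%:Z)) <= 2)%N
      & (\rank (\sum_(1 <= i < p.-1) fdiff f i%:Z)%R <= 2)%N].
Proof.
have hf : rank1_quasihom f.
  split=> // x; have /is_hermitianmxP := hsym x.
  by rewrite expr0 scale1r map_mx_id.
have span3 (A : 'M[K]_n) :
    (forall j : int, (j != 0) && (j != -1) -> (fdiff f j <= A)%MS) ->
    (2 < \rank A)%N.
  (* Every finite subsum of column spaces lies in that of [A^T], which bounds [\dim V] by the rank
     of [A]. *)
  move=> hA; rewrite -mxrank_tr; apply: leq_trans hdim (leq_trans _ (dim_colspace _)).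
  apply/dimvS/subvP => v /hS[s /allP sP]; apply/subvP; rewrite big_seq.
  apply: (big_ind (fun X => X <= colspace A^T)%VS) => [|X Y XA YA|i /sP hi].
  - exact: sub0v.
  - by rewrite subv_add XA.
  - by apply: colspaceS (hA _ hi); apply: qh_diff_sym.
have [p hp] := rank1_quasihom_period hK hf span3.
have [_ _ [W rW hW]] := hp.
have hW' i : (1 <= i < p.-1)%N -> (fdiff f i%:Z <= W)%MS by move=> hi; apply: hW; lia.
exists p; split; first exact: has_period_apap.
- apply: leq_trans rW; rewrite -mxrank_tr; apply: leq_trans (dim_colspace _).
  apply/dimvS; rewrite big_nat.
  apply: (big_ind (fun X => X <= colspace W^T)%VS) => [|X Y XW YW|i hi].
  + exact: sub0v.
  + by rewrite subv_add XW.
  + by apply: colspaceS (hW' _ hi); apply: qh_diff_sym.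
- apply: leq_trans rW; apply: mxrankS; rewrite big_nat.
  exact: summx_sub.
Qed.
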